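(* Let $q$ be a prime power, let $m_1,m_2\ge 1$, and let $S_i\subseteq K_q^{m_i}\cap\mathbb{Z}^{m_i}$ for $i=1,2$ be nonempty lattice sets. Let $S=S_1\times S_2\subset\mathbb{R}^{m_1}\times\mathbb{R}^{m_2}$. Then $$d(S)=d(S_1)\,d(S_2).$$
   Context: $\mathbb{F}_q$ is the finite field with $q$ elements and $\mathbb{F}_q^*=\mathbb{F}_q\setminus\{0\}$. For $r\ge 1$ let $K_q^r=[0,q-2]^r\subset\mathbb{R}^r$. For a nonempty set $A\subseteq K_q^r\cap\mathbb{Z}^r$, let $\mathcal{L}(A)=\operatorname{span}_{\mathbb{F}_q}\{t^a : a\in A\}$, where $t^a=t_1^{a_1}\cdots t_r^{a_r}$. The generalized toric code $\mathcal{C}_A$ is the image of the evaluation map $\mathcal{L}(A)\to\mathbb{F}_q^{(q-1)^r}$, $f\mapsto (f(p))_{p\in(\mathbb{F}_q^* )^r}$. This map is injective because $A\subseteq K_q^r$. The minimum distance $d(A)=d(\mathcal{C}_A)$ is the minimum weight (number of nonzero entries) of a nonzero codeword. Equivalently, it is the minimum over nonzero $f\in\mathcal{L}(A)$ of the number of points of $(\mathbb{F}_q^* )^r$ at which $f$ does not vanish. Here $d(S)$ is computed in $\mathbb{R}^{m_1+m_2}$ and $d(S_i)$ in $\mathbb{R}^{m_i}$. *)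

(* Defs.v *)
From HB Require Import structures.
From mathcomp Require Import all_boot all_order all_algebra.
From mathcomp Require Export mpoly.

Set Implicit Arguments.
Unset Strict Implicit.
Unset Printing Implicit Defensive.

Import Order.TTheory GRing.Theory.
Local Open Scope ring_scope.

Section ToricCode.

Variables (F : finFieldType) (r : nat).

(* With q = #|F|, 'I_q.-1 = {0, ..., q-2}: these row vectors are exactly the
   integer points of [0, q-2]^r. *)
Definition lattice_pt := 'rV['I_(#|F|.-1)]_r.

Definition torus_pt := 'rV[{unit F}]_r.

Definition word := {ffun torus_pt -> F}.

Definition monomial (a : lattice_pt) : {mpoly F[r]} :=
  'X_[[multinom (a ord0 i : nat) | i < r]].

Definition lincomb (A : {set lattice_pt}) (c : {ffun lattice_pt -> F}) :
  {mpoly F[r]} := \sum_(a in A) c a *: monomial a.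

Definition Lspace (A : {set lattice_pt}) (f : {mpoly F[r]}) : Prop :=
  exists c : {ffun lattice_pt -> F}, f = lincomb A c.

Definition evalw (f : {mpoly F[r]}) : word :=
  [ffun p : torus_pt => f.@[fun i => FinRing.uval (p ord0 i)]].

(* The image of Lspace A under evalw (see toric_codeP), indexed by the finitely
   many coefficient families so that it is a finite set. *)
Definition toric_code (A : {set lattice_pt}) : {set word} :=
  [set evalw (lincomb A c) | c : {ffun lattice_pt -> F}].

Definition weight (w : word) : nat := #|[set p | w p != 0]|.

(* The default value #|torus_pt| is the length (q-1)^r of the code, which bounds
   every weight, so for nonempty A this is the true minimum: see mindist_le and
   mindist_attained. *)
Definition mindist (A : {set lattice_pt}) : nat :=
  \big[minn/#|{: torus_pt}|]_(w in toric_code A | w != 0) weight w.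

Lemma toric_codeP (A : {set lattice_pt}) (w : word) :
  w \in toric_code A <-> exists2 f, Lspace A f & w = evalw f.
Proof.
split=> [/imsetP[c _ ->]|[_ [c ->] ->]]; first by exists (lincomb A c); first exists c.
by apply/imsetP; exists c.
Qed.

Lemma mindist_le (A : {set lattice_pt}) (w : word) :
  w \in toric_code A -> w != 0 -> (mindist A <= weight w)%N.
Proof.
move=> wA w0; rewrite /mindist -minEnat -leEnat.
by apply: bigmin_le_cond; rewrite wA.
Qed.

Lemma mindist_attained (A : {set lattice_pt}) : A != set0 ->
  exists w, [/\ w \in toric_code A, w != 0 & weight w = mindist A].
Proof.
case/set0Pn=> a aA; pose u := evalw (monomial a).
have uN0 p : u p != 0.
  rewrite ffunE mevalX prodf_seq_neq0; apply/allP=> i _ /=.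
  by rewrite expf_neq0 // -unitfE; case: (p _ _).
have u0 : u != 0.
  by apply/eqP=> /ffunP/(_ (const_mx 1%g)) /eqP; rewrite [X in _ == X]ffunE; apply/negP.
have uA : u \in toric_code A.
  apply/toric_codeP; exists (monomial a) => //.
  exists [ffun b => (b == a)%:R].
  rewrite /lincomb (bigD1 a) //= ffunE eqxx scale1r big1 ?addr0 // => b /andP[_ ba].
  by rewrite ffunE (negPf ba) scale0r.
case: (@arg_minnP _ u [pred w | (w \in toric_code A) && (w != 0)] weight).
  by rewrite /= uA.
move=> w /andP[wA w0] wmin; exists w; split=> //; apply/eqP.
rewrite eqn_leq mindist_le // andbT /mindist -minEnat -leEnat.
apply: le_bigmin => [|v vA]; last exact: wmin.
by rewrite leEnat /weight max_card.
Qed.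

End ToricCode.

(* S1 x S2, under the identification Z^m1 x Z^m2 = Z^(m1 + m2) given by
   concatenation of coordinates. *)
Definition lattice_prod (F : finFieldType) (m1 m2 : nat)
    (S1 : {set lattice_pt F m1}) (S2 : {set lattice_pt F m2}) :
    {set lattice_pt F (m1 + m2)} :=
  [set (row_mx a b : lattice_pt F (m1 + m2)) | a in S1, b in S2].

(* Main.v *)
Require Import Defs.
From mathcomp Require Import all_boot all_order all_algebra.

(** View a word of the product code as a function of two blocks of variables
    p1, p2. Freezing either block gives a word of the other factor's code. If the
    word is nonzero at (p1, p2), then freezing p1 gives at least d(S2) values of
    the second block at which it does not vanish, and freezing the second block
    at each of these gives at least d(S1) nonzero entries. Conversely, a product
    of two minimum weight words has weight d(S1) d(S2). *)

Set Implicit Arguments.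
Unset Strict Implicit.
Unset Printing Implicit Defensive.

Import GRing.Theory.
Local Open Scope ring_scope.

Section ProductCode.

Variable F : finFieldType.

Definition monomial_at r (a : lattice_pt F r) (p : torus_pt F r) : F :=
  \prod_(i < r) FinRing.uval (p ord0 i) ^+ a ord0 i.

Lemma evalw_lincombE r (A : {set lattice_pt F r}) c p :
  evalw (lincomb A c) p = \sum_(a in A) c a * monomial_at a p.
Proof.
rewrite ffunE /lincomb raddf_sum /=; apply: eq_bigr => a _.
rewrite mevalZ mevalX; congr (_ * _); apply: eq_bigr => i _.
by rewrite multinomE tnth_mktuple.
Qed.

(** Reduces code membership to a pointwise identity, with coefficients supplied as a plain function;
    the codes of slices and of products are all handled this way. *)
Lemma toric_codeE r (A : {set lattice_pt F r}) (w : word F r)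
    (c : lattice_pt F r -> F) :
  (forall p, w p = \sum_(a in A) c a * monomial_at a p) -> w \in toric_code A.
Proof.
move=> wE; apply/imsetP; exists (finfun c) => //; apply/ffunP=> p.
by rewrite evalw_lincombE wE; apply: eq_bigr => a _; rewrite ffunE.
Qed.

Lemma word_neq0P r (w : word F r) : reflect (exists p, w p != 0) (w != 0).
Proof.
apply: (iffP idP) => [w0|[p]]; last first.
  by apply: contra_neq => ->; rewrite ffunE.
apply/existsP; apply: contraNT w0; rewrite negb_exists => /forallP w0.
by apply/eqP/ffunP=> p; rewrite [RHS]ffunE; apply/eqP; rewrite -[_ == _]negbK.
Qed.

Variables m1 m2 : nat.

Lemma monomial_at_row_mx (a : lattice_pt F m1) (b : lattice_pt F m2) p1 p2 :
  monomial_at (row_mx a b : lattice_pt F (m1 + m2)) (row_mx p1 p2)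
  = monomial_at a p1 * monomial_at b p2.
Proof.
rewrite /monomial_at big_split_ord /=; congr (_ * _); apply: eq_bigr => i _.
  by rewrite !row_mxEl.
by rewrite !row_mxEr.
Qed.

Lemma big_lattice_prod (S1 : {set lattice_pt F m1}) (S2 : {set lattice_pt F m2})
    (f : lattice_pt F (m1 + m2) -> F) :
  \sum_(s in lattice_prod S1 S2) f s
  = \sum_(a in S1) \sum_(b in S2) f (row_mx a b).
Proof.
(* Concatenation is injective, so no two pairs of exponents merge into one term. *)
rewrite /lattice_prod curry_imset2X big_imset /=; last first.
  by move=> [a b] [a' b'] _ _ /= /eq_row_mx[-> ->].
by rewrite pair_big; apply: eq_big => [[a b]|[a b] _] //=; rewrite inE.
Qed.

Definition word_l (w : word F (m1 + m2)) (p2 : torus_pt F m2) : word F m1 :=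
  [ffun p1 => w (row_mx p1 p2)].

Definition word_r (w : word F (m1 + m2)) (p1 : torus_pt F m1) : word F m2 :=
  [ffun p2 => w (row_mx p1 p2)].

(** The support is partitioned according to the second block of the point. *)
Lemma weight_word_l w : weight w = (\sum_p2 weight (word_l w p2))%N.
Proof.
under eq_bigr do rewrite /weight -sum1dep_card.
rewrite /weight -sum1dep_card pair_big_dep /=.
rewrite (reindex (fun p : torus_pt F m2 * torus_pt F m1 => row_mx p.2 p.1)).
  by apply: eq_bigl => p; rewrite ffunE.
exists (fun p => (rsubmx p, lsubmx p)) => [[p2 p1] _|p _] /=.
  by rewrite row_mxKl row_mxKr.
by rewrite hsubmxK.
Qed.

Variables (S1 : {set lattice_pt F m1}) (S2 : {set lattice_pt F m2}).

(** At fixed [p2] the factor [monomial_at b p2] is a scalar, so the terms sharing the exponent [a]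
    collapse into a single coefficient. *)
Lemma word_l_code w p2 :
  w \in toric_code (lattice_prod S1 S2) -> word_l w p2 \in toric_code S1.
Proof.
case/imsetP=> c _ ->.
apply: (toric_codeE
  (c := fun a => \sum_(b in S2) c (row_mx a b) * monomial_at b p2)) => p1.
rewrite ffunE evalw_lincombE big_lattice_prod; apply: eq_bigr => a _.
rewrite mulr_suml; apply: eq_bigr => b _.
by rewrite monomial_at_row_mx mulrA mulrAC.
Qed.

Lemma word_r_code w p1 :
  w \in toric_code (lattice_prod S1 S2) -> word_r w p1 \in toric_code S2.
Proof.
case/imsetP=> c _ ->.
apply: (toric_codeE
  (c := fun b => \sum_(a in S1) c (row_mx a b) * monomial_at a p1)) => p2.
rewrite ffunE evalw_lincombE big_lattice_prod exchange_big.
apply: eq_bigr => b _; rewrite mulr_suml; apply: eq_bigr => a _.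
by rewrite monomial_at_row_mx mulrA.
Qed.

Lemma weight_prod_ge w : w \in toric_code (lattice_prod S1 S2) -> w != 0 ->
  (mindist S1 * mindist S2 <= weight w)%N.
Proof.
move=> wS /word_neq0P[p wp0]; pose u := word_r w (lsubmx p).
have u0 : u != 0 by apply/word_neq0P; exists (rsubmx p); rewrite ffunE hsubmxK.
have := mindist_le (word_r_code (lsubmx p) wS) u0.
move=> /(leq_mul (leqnn (mindist S1)))/leq_trans; apply.
rewrite weight_word_l /weight -sum1dep_card big_distrr /=.
(* Only the [p2] in the support of [u] are kept. There [word_l w p2] takes the nonzero value [u p2]
   at [lsubmx p], so its weight is at least [mindist S1]. *)
rewrite [X in (_ <= X)%N](bigID (fun p2 => u p2 != 0)) /=.
apply: leq_trans (leq_addr _ _); apply: leq_sum => p2 up2; rewrite muln1.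
apply: mindist_le; first exact: word_l_code.
by apply/word_neq0P; exists (lsubmx p); move: up2; rewrite !ffunE.
Qed.

Definition word_prod (w1 : word F m1) (w2 : word F m2) : word F (m1 + m2) :=
  [ffun p => w1 (lsubmx p) * w2 (rsubmx p)].

(** Multiplying the two expansions gives the tensor product of the coefficient families. *)
Lemma word_prod_code w1 w2 : w1 \in toric_code S1 -> w2 \in toric_code S2 ->
  word_prod w1 w2 \in toric_code (lattice_prod S1 S2).
Proof.
move=> /imsetP[c1 _ ->] /imsetP[c2 _ ->].
apply: (toric_codeE (c := fun s => c1 (lsubmx s) * c2 (rsubmx s))) => p.
rewrite ffunE !evalw_lincombE big_lattice_prod mulr_suml.
apply: eq_bigr => a _; rewrite mulr_sumr; apply: eq_bigr => b _.
by rewrite row_mxKl row_mxKr -{3}[p]hsubmxK monomial_at_row_mx mulrACA.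
Qed.

Lemma weight_word_prod w1 w2 :
  weight (word_prod w1 w2) = (weight w1 * weight w2)%N.
Proof.
rewrite weight_word_l [weight w2]/weight -sum1dep_card big_distrr /= big_mkcond.
rewrite [RHS]big_mkcond; apply: eq_bigr => p2 _ /=; rewrite muln1.
(* The slice at [p2] is [w1] scaled by [w2 p2]: it is zero, or it has the same support as [w1]. *)
have [w20|w20] := eqVneq (w2 p2) 0.
  apply/eqP; rewrite cards_eq0; apply/eqP/setP=> p1.
  by rewrite !inE !ffunE row_mxKr w20 mulr0 eqxx.
apply: eq_card => p1.
by rewrite !inE !ffunE row_mxKl row_mxKr mulf_eq0 (negPf w20) orbF.
Qed.

Lemma word_prod_neq0 w1 w2 : w1 != 0 -> w2 != 0 -> word_prod w1 w2 != 0.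
Proof.
move=> /word_neq0P[p1 w1p] /word_neq0P[p2 w2p]; apply/word_neq0P.
by exists (row_mx p1 p2); rewrite ffunE row_mxKl row_mxKr mulf_neq0.
Qed.

End ProductCode.

Local Close Scope ring_scope.

Theorem corollary3p2 (F : finFieldType) (m1 m2 : nat)
    (S1 : {set lattice_pt F m1}) (S2 : {set lattice_pt F m2})
    (hm1 : (0 < m1)%N) (hm2 : (0 < m2)%N)
    (hS1 : S1 != set0) (hS2 : S2 != set0) :
  mindist (lattice_prod S1 S2) = (mindist S1 * mindist S2)%N.
Proof.
(* Nonemptiness ensures that the minimum for the product code is attained by a nonzero word, to
   which the lower bound applies. *)
have hS : lattice_prod S1 S2 != set0.
  have [/set0Pn[a aS] /set0Pn[b bS]] := (hS1, hS2).
  by apply/set0Pn; exists (row_mx a b); apply/imset2P; exists a b.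
apply/eqP; rewrite eqn_leq; apply/andP; split.
  have [w1 [w1S w10 <-]] := mindist_attained hS1.
  have [w2 [w2S w20 <-]] := mindist_attained hS2.
  rewrite -weight_word_prod.
  by apply: mindist_le; [exact: word_prod_code | exact: word_prod_neq0].
by have [w [wS w0 <-]] := mindist_attained hS; apply: weight_prod_ge.
Qed.
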